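(* Let $q\ge3$ be an integer and $0\le\beta<1$. Let $\mathcal{G}$ be a family of finite graphs such that (i) the function $\delta$ defined by $\delta(d)=\frac{2(1-\beta)}{q-1-(1-\beta)d}$ if $d\le\frac{q-1}{1-\beta}-2$ and $\delta(d)=1$ otherwise, is a contraction function for $\mathcal{G}$; and (ii) if $\beta=0$, every graph in $\mathcal{G}$ is properly $q$-colorable. Then the $q$-state Potts model with activity $\beta$ exhibits strong spatial mixing on all graphs in $\mathcal{G}$: there exist constants $C>0$ and $0<\gamma<1$ such that for every $G=(V,E)\in\mathcal{G}$ with $n=|V|$, every $v\in V$, every $\Lambda\subseteq V$, every $x\in[q]$, and every $\sigma,\tau\in[q]^\Lambda$ such that $\Omega_1=(G,\Lambda,\sigma)$ and $\Omega_2=(G,\Lambda,\tau)$ are both feasible, $$\left|\Pr_{\Omega_1}[c(v)=x]-\Pr_{\Omega_2}[c(v)=x]\right|\le n^C\gamma^{\mathrm{dist}_G(v,D)},$$ where $D\subseteq\Lambda$ is the set of vertices on which $\sigma$ and $\tau$ differ.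
   Context: Potts model: fix an integer $q\ge2$ and a real $\beta\ge0$ (activity); $[q]=\{1,\dots,q\}$ and $0^0=1$. For a finite undirected graph $G=(V,E)$, an instance is a triple $\Omega=(G,\Lambda,\sigma)$ with $\Lambda\subseteq V$ and $\sigma\in[q]^\Lambda$. For $\pi\in[q]^V$, $w_\Omega(\pi)=\beta^{|\{uv\in E:\pi(u)=\pi(v)\}|}$ if $\pi$ agrees with $\sigma$ on $\Lambda$, and $w_\Omega(\pi)=0$ otherwise. $\Omega$ is feasible if some $\pi$ has $w_\Omega(\pi)>0$; then $Z(\Omega)=\sum_{\pi\in[q]^V}w_\Omega(\pi)$ and the Gibbs measure is $\Pr_\Omega[c(V)=\pi]=w_\Omega(\pi)/Z(\Omega)$ ($c$ is the random configuration); $\Pr_\Omega[c(v)=x]$ and $\Pr_\Omega[c(S)=\pi]$ are its marginals. $\mathrm{dist}_G(v,D)$ is the minimum graph distance from $v$ to a vertex of $D$ (taken to be $+\infty$ if $D=\emptyset$ or no vertex of $D$ is reachable, with $\gamma^{+\infty}=0$). Self-avoiding walks and contraction function: $\mathsf{SAW}(v,\ell)$ is the set of self-avoiding walks $(v,v_1,\dots,v_\ell)$ in $G$ with $\ell$ edges from $v$; $\mathcal{E}_\delta(v,\ell)=\sum_{(v,v_1,\dots,v_\ell)\in\mathsf{SAW}(v,\ell)}\prod_{i=1}^\ell\delta(\deg_G(v_i))$; $\delta:\mathbb{N}\to\mathbb{R}^+$ is a contraction function for a family $\mathcal{G}$ if there are constants $C>0$, $0<\gamma<1$ with $\mathcal{E}_\delta(v,\ell)<n^C\gamma^\ell$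 for every $G=(V,E)\in\mathcal{G}$, $n=|V|$, every vertex $v$ and every $\ell\ge1$. *)

(* Defs.v *)
From Stdlib Require Import Reals ClassicalEpsilon.
From mathcomp Require Import all_boot.
Local Open Scope R_scope.

Set Implicit Arguments.
Unset Strict Implicit.
Unset Printing Implicit Defensive.

Record graph := Graph {
  gV : finType;
  gadj : rel gV;
  gadj_sym : symmetric gadj;
  gadj_irr : irreflexive gadj
}.

Section Defs.
Variable G : graph.
Local Notation V := (gV G).
Local Notation adj := (@gadj G).

Definition nverts : nat := #|V|.

Definition deg (v : V) : nat := #|[set u : V | adj v u]|.

Definition edges : {set {set V}} :=
  [set e : {set V} | [exists u, [exists w, adj u w && (e == [set u; w])]]].

Definition Rsum (I : finType) (P : pred I) (F : I -> R) : R :=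
  \big[Rplus/0]_(i | P i) F i.

(* (v, v_1, ..., v_l) is a self-avoiding walk with l edges, encoded by the
   tuple t = (v_1,...,v_l) *)
Definition is_saw (v : V) (l : nat) (t : l.-tuple V) : bool :=
  path adj v t && uniq (v :: t).

Definition Edelta (delta : nat -> R) (v : V) (l : nat) : R :=
  Rsum (fun t : l.-tuple V => is_saw v t)
       (fun t => \big[Rmult/1]_(u <- tval t) delta (deg u)).

Variable q : nat.

Definition config := {ffun V -> 'I_q}.

Definition boundary (Lam : {set V}) := {ffun {x : V | x \in Lam} -> 'I_q}.

Definition nmono (pi : config) : nat :=
  #|[set e in edges | [forall u in e, [forall w in e, pi u == pi w]]]|.

Definition agrees (Lam : {set V}) (sigma : boundary Lam) (pi : config) : bool :=
  [forall x : {x : V | x \in Lam}, pi (val x) == sigma x].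

(* w_Omega(pi) for Omega = (G, Lam, sigma); pow 0 0 = 1 *)
Definition weight (beta : R) (Lam : {set V}) (sigma : boundary Lam)
  (pi : config) : R :=
  if agrees sigma pi then (beta ^ nmono pi) else 0.

Definition feasible (beta : R) (Lam : {set V}) (sigma : boundary Lam) : Prop :=
  exists pi : config, (0 < weight beta sigma pi).

Definition Zpart (beta : R) (Lam : {set V}) (sigma : boundary Lam) : R :=
  Rsum predT (fun pi : config => weight beta sigma pi).

Definition marginal (beta : R) (Lam : {set V}) (sigma : boundary Lam)
  (v : V) (x : 'I_q) : R :=
  (Rsum (fun pi : config => pi v == x) (fun pi => weight beta sigma pi)
   / Zpart beta sigma).

Definition q_colorable : Prop :=
  exists pi : config, forall u w : V, adj u w -> pi u != pi w.

Definition walk_to (v : V) (D : {set V}) (l : nat) : bool :=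
  [exists t : l.-tuple V, path adj v t && (last v t \in D)].

(* gamma ^ dist_G(v, D), with gamma^(+infinity) = 0 when D is empty or
   unreachable from v; dist_G(v,D) = least l with a walk of length l from v
   into D. *)
Definition pow_dist (gamma : R) (v : V) (D : {set V}) : R :=
  match excluded_middle_informative (exists l, walk_to v D l) with
  | left h => (gamma ^ ex_minn h)
  | right _ => 0
  end.

Definition disagree (Lam : {set V}) (sigma tau : boundary Lam) : {set V} :=
  [set val x | x in [pred x : {x : V | x \in Lam} | sigma x != tau x]].

End Defs.

Definition contraction (fam : graph -> Prop) (delta : nat -> R) : Prop :=
  (forall d, 0 < delta d) /\
  exists (C gamma : R), (0 < C) /\ (0 < gamma < 1) /\
    forall G : graph, fam G -> forall (v : gV G) (l : nat), (1 <= l)%N ->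
      (@Edelta G delta v l < Rpower (INR (nverts G)) C * gamma ^ l).

Definition delta_potts (q : nat) (beta : R) (d : nat) : R :=
  if Rle_dec (INR d) ((INR q - 1) / (1 - beta) - 2)
  then (2 * (1 - beta) / (INR q - 1 - (1 - beta) * INR d))
  else 1.

(* Main.v *)
Require Import Defs.
From Stdlib Require Import Reals ClassicalEpsilon.
From mathcomp Require Import all_boot all_order all_algebra.
From mathcomp Require Import reals Rstruct sequences exp.
From mathcomp Require Import ring lra zify.

(** Pinned vertices act on the free ones through counts [k u y] of pinned
    neighbours of colour [y].  For a free set [S] split into a block [S \ O] and
    its outside [O], compare the laws of the block under two such fields [k1],
    [k2] that differ only on a set [T] disjoint from the block.  If an outer
    neighbour of the block is a vertex with factor 1, it is absorbed into the
    block: the law of the larger block controls that of the smaller one.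
    Otherwise every edge leaving the block ends at a vertex [w] of low degree;
    pinning these edges one at a time multiplies the partition function by
    [1 - (1 - beta) p], where [p] is a marginal at [w], and the degree bound gives
    [p <= 1 / (q - (1 - beta) (deg w - 1))].  So the log-oscillation at the block is
    at most the sum over these edges of [dl w] times the log-oscillation at [w],
    the factor 2 in [dl] coming from comparing two colourings of the block.
    Unfolding the recursion yields a sum over self-avoiding walks ending in [T].
    A bound [M >= 1] is trivial, since marginals differ by at most 1; this is how
    the recursion stops at [T], where ratios may be infinite when [beta = 0]. *)

Set Implicit Arguments.
Unset Strict Implicit.
Unset Printing Implicit Defensive.

(** * Energies under a field and their splitting across a boundary *)

Section PottsFields.
Import Order.TTheory GRing.Theory Num.Theory.
Local Open Scope ring_scope.

Variables (G : graph) (q : nat).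
Local Notation V := (gV G).
Local Notation adj := (@gadj G).
Local Notation config := (config G q).
Implicit Types (S O : {set V}) (pi xi zeta : config) (k : V -> 'I_q -> nat).

Definition upd xi w y : config := [ffun u => if u == w then y else xi u].
Definition glue O pi xi : config := [ffun u => if u \in O then pi u else xi u].
Definition agree_off O xi pi := [forall x, (x \notin O) ==> (pi x == xi x)].
Definition dedge (u w : V) := adj u w && (enum_rank u < enum_rank w)%N.

(* [k u y] is the number of pinned neighbours of [u] coloured [y]; edges are
   oriented by [dedge] so that each one is counted once. *)
Definition cost k S pi : nat :=
  (\sum_(u in S) k u (pi u) +
   \sum_(u in S) \sum_(w in S | dedge u w) (pi u == pi w))%N.

Lemma agree_offP O xi pi :
  reflect (forall x, x \notin O -> pi x = xi x) (agree_off O xi pi).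
Proof.
apply: (iffP forallP) => [h x xO|h x]; last by apply/implyP => /h ->.
by apply/eqP; have /implyP := h x; apply.
Qed.

Lemma agree_off_glue O pi xi : agree_off O xi (glue O pi xi).
Proof. by apply/agree_offP => x /negbTE xO; rewrite ffunE xO. Qed.

Lemma dedgeC u w : adj u w -> dedge u w = ~~ dedge w u.
Proof.
move=> uw; rewrite /dedge uw gadj_sym uw /=.
case: ltngtP => // /ord_inj /enum_rank_inj e.
by move: uw; rewrite e gadj_irr.
Qed.

Lemma cost_congr k S pi xi :
  (forall u, u \in S -> pi u = xi u) -> cost k S pi = cost k S xi.
Proof.
move=> h; congr (_ + _)%N; first by apply: eq_bigr => u /h ->.
by apply: eq_bigr => u /h ->; apply: eq_bigr => w /andP[/h -> _].
Qed.

Lemma cost_congr_field k k' S pi :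
  (forall u, u \in S -> k u =1 k' u) -> cost k S pi = cost k' S pi.
Proof. by move=> h; congr (_ + _)%N; apply: eq_bigr => u /h ->. Qed.

Lemma sum_setD (A : nmodType) S O (F : V -> A) (P : pred V) : O \subset S ->
  \sum_(u in S | P u) F u
  = \sum_(u in S :\: O | P u) F u + \sum_(u in O | P u) F u.
Proof.
move=> OS; rewrite (bigID (fun u => u \in O)) /= addrC; congr (_ + _).
  by apply: eq_bigl => u; rewrite inE; case: (u \in O); rewrite ?andbF ?andbT.
apply: eq_bigl => u; case: (boolP (u \in O)); rewrite ?andbF //= andbT.
by move=> /(subsetP OS) ->.
Qed.

(** The two end sets are disjoint, so [adj] meets each crossing edge once. *)
Definition cross O S pi xi : nat :=
  (\sum_(u in S :\: O) \sum_(w in O | adj u w) (xi u == pi w))%N.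

Lemma cost_split k O S pi : O \subset S ->
  cost k S pi = (cost k (S :\: O) pi + (cost k O pi + cross O S pi pi))%N.
Proof.
move=> OS; rewrite /cost.
have sD F : (\sum_(u in S) F u = \sum_(u in S :\: O) F u + \sum_(u in O) F u)%N.
  by rewrite (big_setID O) /= (setIidPr OS) addnC.
rewrite (sD (fun u => k u (pi u))) sD.
have e1 (D : {set V}) : (\sum_(u in D) \sum_(w in S | dedge u w) (pi u == pi w) =
  \sum_(u in D) \sum_(w in S :\: O | dedge u w) (pi u == pi w)
  + \sum_(u in D) \sum_(w in O | dedge u w) (pi u == pi w))%N.
  rewrite -big_split /=; apply: eq_bigr => u _.
  exact: (sum_setD (fun w => (pi u == pi w) : nat) (dedge u) OS).
rewrite !e1.
(* [dedge] directs a crossing edge either out of [O] or into it, and by [dedgeC] never both, so the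
   two partial sums make up [cross]. *)
have -> : cross O S pi pi =
   (\sum_(u in S :\: O) \sum_(w in O | dedge u w) (pi u == pi w)
    + \sum_(u in O) \sum_(w in S :\: O | dedge u w) (pi u == pi w))%N.
  rewrite [X in (_ + X)%N](exchange_big_dep (fun w => w \in S :\: O)) /=; last first.
    by move=> u w _ /andP[].
  rewrite -big_split /=; apply: eq_bigr => u uS.
  rewrite (bigID (fun w => dedge u w)) /=; congr (_ + _)%N.
    by apply: eq_bigl => w; rewrite /dedge; case: (adj u w); rewrite ?andbF ?andbT.
  rewrite (eq_bigl (fun w => (w \in O) && ((u \in S :\: O) && dedge w u))).
    by apply: eq_bigr => w _; rewrite eq_sym.
  move=> w; rewrite uS /=; case: (boolP (adj u w)) => [uw|/negbTE uw].
    by rewrite (dedgeC uw) negbK andbT.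
  by rewrite /dedge [adj w u]gadj_sym uw !andbF.
lia.
Qed.

(** The pairs are (pinned end, free end); a list lets the field be built one edge at a time. *)
Definition pin (s : seq (V * V)) xi k : V -> 'I_q -> nat :=
  fun w y => (k w y + count (fun e => (e.2 == w) && (xi e.1 == y)) s)%N.

Lemma pin_nil xi k w : pin [::] xi k w =1 k w.
Proof. by move=> y; rewrite /pin addn0. Qed.

Lemma cost_pin s xi k O pi : all (fun e => e.2 \in O) s ->
  cost (pin s xi k) O pi =
  (cost k O pi + count (fun e => xi e.1 == pi e.2) s)%N.
Proof.
move=> sO; rewrite /cost /pin big_split /=.
suff -> : (\sum_(u in O) count (fun e => (e.2 == u) && (xi e.1 == pi u)) s =
  count (fun e => xi e.1 == pi e.2) s)%N by rewrite addnAC.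
elim: s sO => [|e s IH] /=; first by rewrite big1.
move=> /andP[eO /IH <-]; rewrite big_split /=; congr (_ + _)%N.
rewrite (bigD1 e.2) //= eqxx /= big1 ?addn0 // => u /andP[_ /negbTE ue].
by rewrite eq_sym ue.
Qed.

Definition bedges O S : seq (V * V) :=
  [seq e <- enum {: V * V} | [&& e.1 \in S :\: O, e.2 \in O & adj e.1 e.2]].

Lemma mem_bedges O S e :
  (e \in bedges O S) = [&& e.1 \in S :\: O, e.2 \in O & adj e.1 e.2].
Proof. by rewrite mem_filter mem_enum andbT. Qed.

Lemma bedges_uniq O S : uniq (bedges O S).
Proof. by rewrite filter_uniq // enum_uniq. Qed.

Lemma sum_bedges (A : nmodType) O S (F : V -> V -> A) :
  \sum_(e <- bedges O S) F e.1 e.2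
  = \sum_(u in S :\: O) \sum_(w in O | adj u w) F u w.
Proof.
by rewrite big_filter big_enum_cond pair_big_dep /=; apply: eq_bigl => e /=.
Qed.

Lemma count_bedges O S pi xi :
  count (fun e => xi e.1 == pi e.2) (bedges O S) = cross O S pi xi.
Proof.
rewrite -sumn_count sumnE big_map.
exact: (@sum_bedges nat O S (fun u w => (xi u == pi w) : nat)).
Qed.

(** Spatial Markov property: a block with fixed colours acts on [O] only through a field along the
    boundary edges. *)
Lemma cost_split_pin k O S pi xi : O \subset S ->
  (forall u, u \in S :\: O -> pi u = xi u) ->
  cost k S pi =
  (cost k (S :\: O) xi + cost (pin (bedges O S) xi k) O pi)%N.
Proof.
move=> OS h; rewrite (cost_split k _ OS) (cost_congr k h) cost_pin; last first.
  by apply/allP => e; rewrite mem_bedges => /and3P[].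
rewrite count_bedges; congr (_ + (_ + _))%N.
by apply: eq_bigr => u /h ->.
Qed.

Lemma cost_le k O S pi : O \subset S -> (cost k O pi <= cost k S pi)%N.
Proof. by move=> OS; rewrite (cost_split k pi OS); lia. Qed.

Lemma agree_off_upd O xi w y pi : w \in O ->
  agree_off (O :\ w) (upd xi w y) pi = agree_off O xi pi && (pi w == y).
Proof.
move=> wO; apply/agree_offP/andP => [h|[/agree_offP h /eqP <-] x].
  split; last by rewrite h ?inE ?eqxx // ffunE eqxx.
  apply/agree_offP => x xO; rewrite h ?inE ?(negbTE xO) ?andbF // ffunE.
  by case: eqP => // e; rewrite e wO in xO.
by rewrite !inE negb_and negbK ffunE; case: eqP => [->|_ /h].
Qed.

Section Sums.
Variable A : nmodType.

Lemma sum_agree_off_partition O xi w (F : config -> A) : w \in O ->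
  \sum_(pi | agree_off O xi pi) F pi
  = \sum_y \sum_(pi | agree_off (O :\ w) (upd xi w y) pi) F pi.
Proof.
move=> wO; rewrite (partition_big (fun pi : config => pi w) predT) //=.
by apply: eq_bigr => y _; apply: eq_bigl => pi; rewrite agree_off_upd.
Qed.

Lemma sum_agree_off_glue O xi zeta (F : config -> A) :
  \sum_(pi | agree_off O xi pi) F pi
  = \sum_(pi | agree_off O zeta pi) F (glue O pi xi).
Proof.
rewrite (reindex_onto (fun pi => glue O pi xi) (fun pi => glue O pi zeta)).
  apply: eq_bigl => pi; rewrite agree_off_glue /=.
  apply/eqP/agree_offP => [<- x /negbTE xO|h]; first by rewrite ffunE xO.
  by apply/ffunP => x; rewrite !ffunE; case: (boolP (x \in O)) => // /h.
move=> pi /agree_offP h; apply/ffunP => x; rewrite !ffunE.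
by case: (boolP (x \in O)) => // /h.
Qed.
End Sums.

End PottsFields.

(** * Partition functions: pinning an edge, bounding a marginal, positivity *)

Section PartitionFunctions.
Import Order.TTheory GRing.Theory Num.Theory.
Local Open Scope ring_scope.

Variables (G : graph) (q : nat) (R : realType) (beta : R).
Hypotheses (beta0 : 0 <= beta) (beta1 : beta < 1).
Local Notation V := (gV G).
Local Notation adj := (@gadj G).
Local Notation config := (config G q).
Implicit Types (S O : {set V}) (pi xi zeta : config) (k : V -> 'I_q -> nat).

Definition wt k S pi : R := beta ^+ cost k S pi.
(** [agree_off] also freezes the vertices outside [S], so that each colouring of [O] contributes
    exactly one term. *)
Definition Zf k S O xi : R := \sum_(pi | agree_off O xi pi) wt k S pi.

Lemma W_ge0 k S pi : 0 <= wt k S pi. Proof. exact: exprn_ge0. Qed.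

Lemma Z_ge0 k S O xi : 0 <= Zf k S O xi.
Proof. by apply: sumr_ge0 => pi _; apply: W_ge0. Qed.

Lemma Z_congr k S O xi zeta :
  (forall u, u \in S :\: O -> xi u = zeta u) -> Zf k S O xi = Zf k S O zeta.
Proof.
move=> h; rewrite /Zf (sum_agree_off_glue _ xi zeta).
apply: eq_bigr => pi /agree_offP pz; congr (_ ^+ _); apply: cost_congr => u uS.
rewrite ffunE; case: (boolP (u \in O)) => // uO.
by rewrite pz // h // inE uO.
Qed.

Lemma Z_congr_field k k' S O xi :
  (forall u, u \in S -> k u =1 k' u) -> Zf k S O xi = Zf k' S O xi.
Proof.
by move=> h; apply: eq_bigr => pi _; rewrite /wt (cost_congr_field _ h).
Qed.

Lemma Z_partition k S O xi w : w \in O ->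
  Zf k S O xi = \sum_y Zf k S (O :\ w) (upd xi w y).
Proof. exact: sum_agree_off_partition. Qed.

Lemma Z_le_partition k S O xi w y : w \in O ->
  Zf k S (O :\ w) (upd xi w y) <= Zf k S O xi.
Proof.
move=> wO; rewrite (Z_partition _ _ _ wO) (bigD1 y) //= lerDl.
by apply: sumr_ge0 => z _; apply: Z_ge0.
Qed.

Lemma Z_split k O O' S xi (eta : config) : O' \subset O -> O \subset S ->
  (forall u, u \in S :\: O -> xi u = eta u) ->
  Zf k S O' xi = wt k (S :\: O) eta * Zf (pin (bedges O S) eta k) O O' xi.
Proof.
move=> O'O OS xe; rewrite /Zf mulr_sumr; apply: eq_bigr => pi /agree_offP h.
rewrite /wt -exprD (@cost_split_pin _ _ k O S pi eta) // => u uS.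
rewrite -xe // h //; move: uS; rewrite inE => /andP[uO _].
by apply: contra uO => /(subsetP O'O).
Qed.

(** A monochromatic edge has factor [beta = 1 - (1 - beta)], any other edge factor 1; the loss is
    thus confined to the colourings that give the free end the pinned colour. *)
Lemma Z_pin_cons e s k O xi zeta : all (fun e => e.2 \in O) (e :: s) ->
  Zf (pin (e :: s) xi k) O O zeta
  = Zf (pin s xi k) O O zeta
    - (1 - beta) * Zf (pin s xi k) O (O :\ e.2) (upd zeta e.2 (xi e.1)).
Proof.
move=> esO; have /andP[eO sO] := esO.
rewrite /Zf (eq_bigl _ _ (fun pi => agree_off_upd _ _ pi eO)).
rewrite big_mkcondr /= mulr_sumr -sumrB; apply: eq_bigr => pi _.
rewrite /wt !cost_pin //= eq_sym.
case: eqP => _; last by rewrite mulr0 subr0 add0n.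
by rewrite add1n addnS exprS; ring.
Qed.

Lemma bernoulli_expr n : 1 - (1 - beta) * n%:R <= beta ^+ n.
Proof.
elim: n => [|n IH]; first by rewrite mulr0 subr0.
have := ler_wpM2l beta0 IH; rewrite -exprS; apply: le_trans.
rewrite -natr1 -subr_ge0.
have -> : beta * (1 - (1 - beta) * n%:R) - (1 - (1 - beta) * (n%:R + 1))
  = (1 - beta) ^+ 2 * n%:R by ring.
by rewrite mulr_ge0 ?sqr_ge0.
Qed.

(** If [n y] neighbours of a vertex have colour [y], it takes [c] with probability [beta ^+ n c]
    over the right-hand sum. Bernoulli bounds this sum from below, and the numerator is at most
    1. *)
Lemma sum_expr_ge (n : 'I_q -> nat) c :
  (q%:R - (1 - beta) * (\sum_y n y)%:R) * beta ^+ n c <= \sum_y beta ^+ n y.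
Proof.
have h : q%:R - (1 - beta) * (\sum_y n y)%:R <= \sum_y beta ^+ n y.
  apply: le_trans (ler_sum _ (fun y _ => bernoulli_expr (n y))).
  by rewrite sumrB sumr_const card_ord -mulr_sumr natr_sum.
have [neg|pos] := leP (q%:R - (1 - beta) * (\sum_y n y)%:R) 0.
  apply: (@le_trans _ _ 0); first by rewrite mulr_le0_ge0 ?exprn_ge0.
  by apply: sumr_ge0 => y _; apply: exprn_ge0.
apply: le_trans h; apply: ler_piMr; first exact: ltW.
by rewrite exprn_ile1 // ltW.
Qed.

Definition load k O w : nat := (\sum_y k w y + #|[set u in O | adj w u]|)%N.

(** Conditionally on any colouring [eta] of the other free vertices this is [sum_expr_ge]; the bound
    survives summation over [eta]. *)
Lemma Z_marginal_le k O w zeta c : w \in O ->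
  (q%:R - (1 - beta) * (load k O w)%:R) * Zf k O (O :\ w) (upd zeta w c)
  <= Zf k O O zeta.
Proof.
move=> wO; rewrite (Z_partition _ _ _ wO) /Zf.
rewrite (sum_agree_off_glue _ _ zeta) mulr_sumr.
under [leRHS]eq_bigr do rewrite (sum_agree_off_glue _ _ zeta).
rewrite exchange_big /=; apply: ler_sum => eta _.
set O' := O :\ w.
have O'O : O' \subset O by apply: subsetDl.
have OD : O :\: O' = [set w].
  by apply/setP => u; rewrite !inE; case: eqP => [->|_] //=; case: (u \in O).
pose n y := (k w y + \sum_(u in O' | adj w u) (y == eta u))%N.
have costE y : wt k O (glue O' eta (upd zeta w y)) =
    beta ^+ cost k O' eta * beta ^+ n y.
  rewrite /wt (cost_split _ _ O'O) OD -exprD; congr (_ ^+ _).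
  rewrite (@cost_congr _ _ k O' _ eta); last by move=> u uO; rewrite ffunE uO.
  rewrite /cost /cross OD !big_set1 /n !ffunE !inE eqxx /=.
  rewrite [X in (_ + X + _)%N]big1; last first.
    move=> u /andP[]; rewrite inE => /eqP ->. by rewrite /dedge gadj_irr.
  rewrite addn0 addnCA; congr (_ + (_ + _))%N; apply: eq_bigr => u /andP[uO _].
  by rewrite ffunE uO.
rewrite (eq_bigr _ (fun y _ => costE y)) costE -mulr_sumr mulrCA.
apply: ler_wpM2l; first exact: exprn_ge0.
have -> : load k O w = (\sum_y n y)%N; last exact: sum_expr_ge.
rewrite big_split /= exchange_big /=; congr (_ + _)%N.
rewrite -sum1_card; apply: eq_big => u; rewrite !inE.
  by case: eqP => [->|_] //=; rewrite gadj_irr andbF.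
by move=> _; rewrite (bigD1 (eta u)) //= eqxx big1 // => y /negbTE ->.
Qed.

Definition admissible k S := exists pi, 0 < wt k S pi.

Lemma admissible_sub k S O : O \subset S -> admissible k S -> admissible k O.
Proof.
move=> OS [pi p]; exists pi; apply: lt_le_trans p _.
by apply: ler_wiXn2l; rewrite ?cost_le // ltW.
Qed.

Lemma Z_gt0 k O xi : admissible k O -> 0 < Zf k O O xi.
Proof.
move=> [pi p]; rewrite /Zf (bigD1 (glue O pi xi)) ?agree_off_glue //=.
apply: ltr_pwDl; last by apply: sumr_ge0 => eta _; apply: W_ge0.
rewrite /wt (@cost_congr _ _ k O _ pi) // => u uO.
by rewrite ffunE uO.
Qed.

Lemma admissible_Z k O xi : 0 < Zf k O O xi -> admissible k O.
Proof.
case: (boolP [exists pi, 0 < wt k O pi]) => [/existsP //|/existsPn nh].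
rewrite /Zf big1 ?ltxx // => pi _; apply/eqP.
by rewrite eq_le W_ge0 andbT leNgt nh.
Qed.

End PartitionFunctions.

(** * Weighted sums over self-avoiding walks *)

Section SelfAvoidingSums.
Import Order.TTheory GRing.Theory Num.Theory.
Local Open Scope ring_scope.

Variables (G : graph) (R : realType).
Local Notation V := (gV G).
Local Notation adj := (@gadj G).
Variables (dl : V -> R) (T : {set V}).
Hypothesis dl_ge0 : forall v, 0 <= dl v.
Implicit Types (S O : {set V}).

(** Walks from [w] inside [O] that end in [T], weighted by [dl] at each vertex after the first;
    deleting [w] from [O] makes them self-avoiding. The fuel [n] bounds the number of vertices. *)
Fixpoint saw_sum n O w : R :=
  if n is m.+1 then
    (w \in T)%:R + \sum_(u in O :\ w | adj w u) dl u * saw_sum m (O :\ w) u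
  else 0.

Definition exit_sum O S : R :=
  \sum_(u in S :\: O) \sum_(w in O | adj u w) dl w * saw_sum #|O| O w.

Lemma saw_sum_ge0 n O w : 0 <= saw_sum n O w.
Proof.
elim: n O w => [|n IH] O w //=; rewrite addr_ge0 ?ler0n //.
by apply: sumr_ge0 => u _; rewrite mulr_ge0.
Qed.

Lemma exit_sum_ge0 O S : 0 <= exit_sum O S.
Proof.
do 2![apply: sumr_ge0 => ? _]; by rewrite mulr_ge0 ?saw_sum_ge0.
Qed.

Lemma ler_sum_sub (P P' : pred V) (F F' : V -> R) :
  (forall u, P u -> P' u) -> (forall u, 0 <= F' u) -> (forall u, F u <= F' u) ->
  \sum_(u | P u) F u <= \sum_(u | P' u) F' u.
Proof.
move=> PP F0 FF; rewrite (bigID P P') /=.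
rewrite [X in _ <= X + _](eq_bigl P); last first.
  by move=> u; apply/andP/idP => [[]//|Pu]; split; rewrite ?PP.
rewrite -[leLHS]addr0 lerD ?ler_sum //.
by apply: sumr_ge0.
Qed.

Lemma saw_sum_mono m n O' O w : (m <= n)%N -> O' \subset O ->
  saw_sum m O' w <= saw_sum n O w.
Proof.
elim: n m O' O w => [|n IH] [|m] O' O w // mn sub; first exact: saw_sum_ge0.
rewrite /= lerD2l; have sub' : O' :\ w \subset O :\ w by apply: setSD.
apply: ler_sum_sub => u.
- by case/andP=> /(subsetP sub') ->.
- by rewrite mulr_ge0 ?saw_sum_ge0.
- by rewrite ler_wpM2l ?IH.
Qed.

(** Seen as the one-vertex block [O :\: (O :\ w)], the vertex [w] turns the first step of a walk
    into an exit; this leads the recursion from boundary edges back to blocks. *)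
Lemma saw_sum_card O w : w \in O ->
  saw_sum #|O| O w = (w \in T)%:R + exit_sum (O :\ w) O.
Proof.
move=> wO; rewrite (cardsD1 w) wO /=; congr (_ + _).
rewrite /exit_sum (_ : O :\: (O :\ w) = [set w]) ?big_set1 //.
by apply/setP => u; rewrite !inE; case: eqP => [->|_] //=; case: (u \in O).
Qed.

(* Moving a vertex of unit factor across the boundary only merges walks: those
   leaving the enlarged block through it were already counted. *)
Lemma exit_sum_grow O S u0 w0 : O \subset S -> u0 \in S :\: O -> w0 \in O ->
  adj u0 w0 -> dl w0 = 1 ->
  (w0 \in T)%:R + exit_sum (O :\ w0) S <= exit_sum O S.
Proof.
move=> OS u0S w0O u0w0 dl1.
have w0S : w0 \in S by apply: (subsetP OS).
pose F w := dl w * saw_sum #|O :\ w0| (O :\ w0) w.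
have -> : exit_sum (O :\ w0) S = \sum_(w in O :\ w0 | adj w0 w) F w
    + \sum_(u in S :\: O) \sum_(w in O :\ w0 | adj u w) F w.
  rewrite /exit_sum (_ : S :\: (O :\ w0) = w0 |: (S :\: O)); last first.
    by apply/setP => u; rewrite !inE; case: eqP => [->|_] //=; rewrite w0S.
  by rewrite big_setU1 ?inE ?w0O.
have -> : (w0 \in T)%:R + (\sum_(w in O :\ w0 | adj w0 w) F w
    + \sum_(u in S :\: O) \sum_(w in O :\ w0 | adj u w) F w)
  = saw_sum #|O| O w0 + \sum_(u in S :\: O) \sum_(w in O :\ w0 | adj u w) F w.
  by rewrite addrA [#|O|](cardsD1 w0) w0O.
have F0 w : 0 <= dl w * saw_sum #|O| O w by rewrite mulr_ge0 ?saw_sum_ge0.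
have FF w : F w <= dl w * saw_sum #|O| O w.
  rewrite ler_wpM2l // saw_sum_mono ?subD1set //.
  by rewrite subset_leq_card ?subD1set.
rewrite /exit_sum (bigD1 u0) //= [leRHS](bigD1 u0) //= addrA; apply: lerD.
  rewrite [leRHS](bigD1 w0) ?w0O //= dl1 mul1r lerD2l.
  apply: ler_sum_sub => // w; rewrite !inE => /andP[/andP[-> ->] ->] //.
apply: ler_sum => u _; apply: ler_sum_sub => // w.
by rewrite !inE => /andP[/andP[_ ->] ->].
Qed.

End SelfAvoidingSums.

(** * Contraction of the log-oscillation under pinning *)

Section Oscillation.
Import Order.TTheory GRing.Theory Num.Theory.
Local Open Scope ring_scope.

Section Loads.
Variables (G : graph) (q : nat).
Local Notation V := (gV G).
Local Notation adj := (@gadj G).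
Implicit Types (S O : {set V}) (k : V -> 'I_q -> nat).

Lemma load_split k O S w : O \subset S ->
  load k S w = (load k O w + #|[set u in S :\: O | adj w u]|)%N.
Proof.
move=> OS; rewrite /load -addnA; congr (_ + _)%N.
rewrite -(cardsID O [set u in S | _]); congr (_ + _)%N; apply: eq_card => u.
  rewrite !inE; case: (boolP (u \in O)); rewrite ?andbF //.
  by move=> /(subsetP OS) ->; rewrite andbT.
by rewrite !inE andbA.
Qed.

Lemma load_pin s (xi : config G q) k O w :
  load (pin s xi k) O w = (load k O w + count (fun e => e.2 == w) s)%N.
Proof.
rewrite /load /pin big_split /= addnAC; congr (_ + _ + _)%N.
elim: s => [|e s IH] /=; first by rewrite big1.
rewrite big_split /= IH; congr (_ + _)%N.
case: (e.2 == w) => /=; last by rewrite big1.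
by rewrite (bigD1 (xi e.1)) //= eqxx big1 // => y; rewrite eq_sym => /negbTE ->.
Qed.

(** Distinct boundary edges ending at [w] have distinct outer ends, all neighbours of [w]. This
    keeps loads within the degree during pinning. *)
Lemma count_bedges_le s O S w : uniq s -> {subset s <= bedges O S} ->
  (count (fun e => e.2 == w) s <= #|[set u in S :\: O | adj w u]|)%N.
Proof.
move=> us sub; rewrite -size_filter -(size_map fst) cardE.
apply: uniq_leq_size.
  rewrite map_inj_in_uniq ?filter_uniq // => -[u x] [u' x'].
  by rewrite !mem_filter /= => /andP[/eqP -> _] /andP[/eqP -> _] ->.
move=> u /mapP[[u' x]]; rewrite mem_filter /= => /andP[/eqP -> /sub].
rewrite mem_bedges /= => /and3P[uS _ a] ->.
by rewrite mem_enum !inE -in_setD uS gadj_sym.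
Qed.
End Loads.

Variables (G : graph) (q : nat) (R : realType) (beta : R).
Hypotheses (beta0 : 0 <= beta) (beta1 : beta < 1).
Local Notation V := (gV G).
Local Notation adj := (@gadj G).
Local Notation config := (config G q).
Local Notation Zf := (Zf beta).
Local Notation admissible := (admissible beta).
Variables (dl : V -> R) (low : pred V) (T : {set V}).
Hypothesis dl_ge0 : forall v, 0 <= dl v.
Hypothesis dl_high : forall v, ~~ low v -> dl v = 1.
Hypothesis low_gt0 :
  forall v, low v -> 0 < q%:R - (1 - beta) * (deg v)%:R.
Hypothesis dl_low : forall v, low v ->
  (1 - beta) / (q%:R - (1 - beta) * (deg v)%:R) <= dl v / 2.
Implicit Types (S O : {set V}) (pi xi zeta : config) (k : V -> 'I_q -> nat).
Local Notation saw_sum := (saw_sum dl T).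
Local Notation exit_sum := (exit_sum dl T).

Definition agree_outside S k1 k2 :=
  forall u, u \in S -> u \notin T -> k1 u =1 k2 u.
Definition within_degree k S O := forall w, w \in O -> (load k S w <= deg w)%N.
(** Between two colourings of the block [S :\: O] the ratio of the two partition functions varies by
    a factor of at most [expR M]. The cross-multiplied form allows zeros, which occur at
    [beta = 0]. *)
Definition osc_le k1 k2 S O (M : R) := forall xi zeta,
  Zf k1 S O xi * Zf k2 S O zeta <= expR M * (Zf k1 S O zeta * Zf k2 S O xi).

(** Both products are double sums over colours of [w], matched term by term after exchanging the
    summations on one side. *)
Lemma osc_le_partition k1 k2 S O w M : w \in O ->
  osc_le k1 k2 S (O :\ w) M -> osc_le k1 k2 S O M.
Proof.
move=> wO h xi zeta; rewrite !(Z_partition beta _ _ _ wO).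
rewrite !mulr_suml mulr_sumr.
under [leLHS]eq_bigr do rewrite mulr_sumr.
under [leRHS]eq_bigr do rewrite !mulr_sumr.
rewrite [leRHS]exchange_big /=.
by apply: ler_sum => y _; apply: ler_sum => z _.
Qed.

(** Summing out only one of the two colours of [w] leaves a comparison of the marginals of [c] at
    [w] under the two fields. *)
Lemma osc_le_point k1 k2 S O w M zeta c : w \in O ->
  osc_le k1 k2 S (O :\ w) M ->
  Zf k1 S O zeta * Zf k2 S (O :\ w) (upd zeta w c)
  <= expR M * (Zf k1 S (O :\ w) (upd zeta w c) * Zf k2 S O zeta).
Proof.
move=> wO h; rewrite !(Z_partition beta _ _ _ wO).
rewrite mulr_suml !mulr_sumr; exact: ler_sum.
Qed.

Lemma osc_le_mono k1 k2 S O M N : M <= N ->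
  osc_le k1 k2 S O M -> osc_le k1 k2 S O N.
Proof.
move=> MN h xi zeta; apply: le_trans (h xi zeta) _.
by rewrite ler_wpM2r ?ler_expR // mulr_ge0 ?Z_ge0.
Qed.

(** Put [p_i = z_i / Z_i]. From [p_2 <= 1 / D] follows [a p_2 <= K (1 - a p_2)]. With
    [(1 - M) p_2 <= p_1] this gives [1 - a p_1 <= (1 - a p_2) (1 + K M)], and
    [1 + K M <= expR (K * M)]. *)
Lemma pin_step (a D K M z1 Z1 z2 Z2 : R) :
  0 <= a -> 0 < D - a -> 0 <= z2 -> 0 <= z1 -> 0 < Z1 -> 0 < Z2 -> D * z2 <= Z2 ->
  a / (D - a) <= K -> 0 <= M ->
  1 <= M \/ Z1 * z2 <= expR M * (z1 * Z2) ->
  (Z1 - a * z1) * Z2 <= expR (K * M) * ((Z2 - a * z2) * Z1).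
Proof.
move=> a0 Da z20 z10 Z1p Z2p Dz aK M0 hM.
have aK' : a <= K * (D - a) by rewrite -ler_pdivrMr.
have K0 : 0 <= K by apply: le_trans aK; rewrite divr_ge0 // ltW.
have h1 : (D - a) * z2 <= Z2 - a * z2 by lra.
have h2 : a * z2 <= K * (Z2 - a * z2).
  apply: le_trans (ler_wpM2l K0 h1); rewrite mulrA; exact: ler_wpM2r.
have hp : 0 <= (Z2 - a * z2) * Z1.
  by rewrite mulr_ge0 ?(ltW Z1p) //; apply: le_trans h1; rewrite mulr_ge0 // ltW.
apply: le_trans (ler_wpM2r hp (expR_ge1Dx (K * M))).
(* For [1 <= M] the left side is nonpositive; otherwise [1 - M <= expR (- M)] linearises the assumed
   comparison. *)
have h3 : (1 - M) * (Z1 * z2) <= z1 * Z2.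
  case: hM => [M1|hM].
    apply: (@le_trans _ _ 0); last by rewrite mulr_ge0 ?(ltW Z2p).
    by rewrite mulr_le0_ge0 ?subr_le0 // mulr_ge0 // ltW.
  have := ler_wpM2l (expR_ge0 (- M)) hM; rewrite [leRHS]mulrA -expRD addNr expR0 mul1r.
  apply: le_trans; apply: ler_wpM2r; first by rewrite mulr_ge0 // ltW.
  exact: expR_ge1Dx.
have h4 : (a * z2) * (Z1 * M) <= K * (Z2 - a * z2) * (Z1 * M).
  by apply: ler_wpM2r h2; rewrite mulr_ge0 // ltW.
have h5 := ler_wpM2l a0 h3; rewrite -subr_ge0 in h4; rewrite -subr_ge0 in h5.
rewrite -subr_ge0; move: (addr_ge0 h4 h5); congr (0 <= _); ring.
Qed.

Lemma pin_gt0 (a D z Z : R) :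
  0 <= a -> 0 < D - a -> 0 < Z -> D * z <= Z -> 0 < Z - a * z.
Proof.
move=> a0 Da Zp Dz; have D0 : 0 < D by lra.
rewrite -(pmulr_rgt0 _ D0); apply: (@lt_le_trans _ _ ((D - a) * Z)).
  by rewrite mulr_gt0.
have := ler_wpM2l a0 Dz; lra.
Qed.

Section Telescope.
Variables (O S : {set V}).
Hypothesis OS : O \subset S.
(** What the induction in [oscillation_bound] supplies: the bound for the one-vertex block [w]
    inside [O]. *)
Hypothesis contract : forall w k1 k2, w \in O -> low w -> agree_outside O k1 k2 ->
  within_degree k1 O O -> within_degree k2 O O ->
  admissible k1 O -> admissible k2 O ->
  1 <= saw_sum #|O| O w \/ osc_le k1 k2 O (O :\ w) (saw_sum #|O| O w).

(** The ratio of the partition functions after and before pinning is a product of one factor per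
    edge, and [pin_step] compares each factor under the two fields. Admissibility is carried along
    to keep the denominators positive. *)
Lemma telescope s k1 k2 xi :
  uniq s -> {subset s <= bedges O S} -> all (fun e => low e.2) s ->
  agree_outside S k1 k2 ->
  within_degree k1 S O -> within_degree k2 S O ->
  admissible k1 O -> admissible k2 O ->
  [/\ admissible (pin s xi k1) O, admissible (pin s xi k2) O &
   Zf (pin s xi k1) O O xi * Zf k2 O O xi
   <= expR (\sum_(e <- s) dl e.2 / 2 * saw_sum #|O| O e.2)
      * (Zf (pin s xi k2) O O xi * Zf k1 O O xi)].
Proof.
move=> us ss ls ag d1 d2 a1 a2; elim: s us ss ls => [|e s IH] us ss ls.
  have Z0 k : Zf (pin [::] xi k) O O xi = Zf k O O xi.
    by apply: Z_congr_field => u _; apply: pin_nil.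
  have ad k : admissible k O -> admissible (pin [::] xi k) O.
    move=> [pi p]; exists pi; move: p; congr (0 < beta ^+ _).
    by apply: cost_congr_field => u _ y; rewrite pin_nil.
  by rewrite !Z0 big_nil expR0 mul1r [leRHS]mulrC; split; [exact: ad|exact: ad|].
have /andP[les lss] := ls; have /andP[_ uss] := us.
have sss : {subset s <= bedges O S} by move=> x xs; rewrite ss // inE xs orbT.
have [{IH} p1 p2 IH] := IH uss sss lss.
have := ss e (mem_head _ _); rewrite mem_bedges => /and3P[_ eO _].
set w := e.2 in eO les *; set c := xi e.1.
have wd k : within_degree k S O -> within_degree (pin s xi k) O O.
  move=> d u uO; apply: leq_trans (d u uO); rewrite load_pin (load_split _ _ OS).
  by rewrite leq_add2l count_bedges_le.
(* Strict, because [e] itself ends at [w] and is not yet pinned. *)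
have wd' k : within_degree k S O -> (load (pin s xi k) O w < deg w)%N.
  move=> d; apply: leq_trans (d w eO); rewrite load_pin (load_split _ _ OS).
  rewrite -addnS leq_add2l; have := count_bedges_le w us ss.
  by rewrite /= eqxx add1n.
have ba : 0 <= 1 - beta by rewrite subr_ge0 ltW.
(* The constant of [Z_marginal_le] for load [deg w - 1]; [D - (1 - beta)] is the denominator in
   [dl_low]. *)
pose D : R := q%:R - (1 - beta) * (deg w)%:R + (1 - beta).
have Dgt : 0 < D - (1 - beta) by rewrite addrK low_gt0.
have marg k : within_degree k S O ->
    D * Zf (pin s xi k) O (O :\ w) (upd xi w c) <= Zf (pin s xi k) O O xi.
  move=> /wd' dk; apply: le_trans (Z_marginal_le beta0 beta1 _ _ c eO).
  apply: ler_wpM2r; first exact: Z_ge0.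
  have : (load (pin s xi k) O w)%:R + 1 <= (deg w)%:R :> R by rewrite natr1 ler_nat.
  move=> /(ler_wpM2l ba); rewrite /D; lra.
have Zp k : admissible (pin s xi k) O -> 0 < Zf (pin s xi k) O O xi.
  by move=> ?; apply: Z_gt0.
have esO : all (fun e => e.2 \in O) (e :: s).
  by apply/allP => x /ss; rewrite mem_bedges => /and3P[].
have pos k : within_degree k S O -> admissible (pin s xi k) O ->
    admissible (pin (e :: s) xi k) O.
  move=> dk pk; apply: (@admissible_Z _ _ _ _ beta0 _ _ xi).
  rewrite Z_pin_cons //; apply: pin_gt0 ba Dgt _ _; [exact: Zp|exact: marg].
split; [exact: pos|exact: pos|].
have ago : agree_outside O (pin s xi k1) (pin s xi k2).
  by move=> u uO uT y; rewrite /pin ag // (subsetP OS).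
have ct := contract eO les ago (wd _ d1) (wd _ d2) p1 p2.
have st : (Zf (pin (e :: s) xi k1) O O xi) * Zf (pin s xi k2) O O xi
   <= expR (dl w / 2 * saw_sum #|O| O w)
      * (Zf (pin (e :: s) xi k2) O O xi * Zf (pin s xi k1) O O xi).
  rewrite !Z_pin_cons //; apply: (pin_step ba Dgt); rewrite ?Z_ge0 ?Zp ?marg //.
  - by rewrite addrK dl_low.
  - exact: saw_sum_ge0.
  - case: ct => [|os]; [by left|right]; exact: osc_le_point.
rewrite big_cons expRD -/w.
have h := ler_pM _ _ st IH.
(* The partition functions pinned by [s] occur on both sides of the product of [st] and [IH] and
   cancel. *)
have pp : 0 < Zf (pin s xi k1) O O xi * Zf (pin s xi k2) O O xi by rewrite mulr_gt0 ?Zp.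
rewrite -(ler_pM2l pp); apply: le_trans (le_trans (h _ _) _).
- by rewrite le_eqVlt; apply/orP; left; apply/eqP; ring.
- by rewrite mulr_ge0 ?Z_ge0.
- by rewrite mulr_ge0 ?Z_ge0.
- by rewrite le_eqVlt; apply/orP; left; apply/eqP; ring.
Qed.

End Telescope.

(** Induction on [#|O|] with [S] and the fields general: it is invoked for a larger block in the
    same [S], and for a one-vertex block with [O] as the new [S]. *)
Lemma oscillation_bound O S k1 k2 :
  O \subset S -> agree_outside S k1 k2 -> (forall u, u \in S :\: O -> u \notin T) ->
  within_degree k1 S O -> within_degree k2 S O ->
  admissible k1 S -> admissible k2 S ->
  1 <= exit_sum O S \/ osc_le k1 k2 S O (exit_sum O S).
Proof.
have [n] := ubnP #|O|; elim: n O S k1 k2 => // n IH O S k1 k2 /ltnSE On.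
move=> OS ag ST d1 d2 a1 a2.
have cardD w : w \in O -> (#|O :\ w| < n)%N.
  by move=> wO; move: On; rewrite (cardsD1 w) wO.
have [hi|nhi] := boolP [exists u in S :\: O, [exists w in O, adj u w && ~~ low w]].
  case/exists_inP: hi => u uS /exists_inP[w wO /andP[uw /dl_high dlw]].
  have gr := exit_sum_grow T dl_ge0 OS uS wO uw dlw.
  have [wT|wT] := boolP (w \in T).
    (* A vertex of [T] may not join the block, but it makes the exit sum at least 1. *)
    left; apply: le_trans gr; rewrite wT lerDl; exact: exit_sum_ge0.
  rewrite (negbTE wT) add0r in gr.
  have sub : O :\ w \subset O by apply: subD1set.
  case: (IH (O :\ w) S k1 k2) => //.
  - exact: cardD.
  - exact: subset_trans OS.
  - move=> v; rewrite !inE; case: eqP => [-> //|_] /=.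
    by move=> vS; apply: ST; rewrite inE.
  - by move=> v /(subsetP sub); apply: d1.
  - by move=> v /(subsetP sub); apply: d2.
  - by move=> h; left; apply: le_trans gr.
  - by move=> h; right; apply: (osc_le_partition wO); apply: osc_le_mono h.
right.
have ls : all (fun e => low e.2) (bedges O S).
  apply/allP => e; rewrite mem_bedges => /and3P[e1 e2 ea].
  apply/negPn; apply: contra nhi => nl; apply/exists_inP; exists e.1 => //.
  by apply/exists_inP; exists e.2 => //; rewrite ea.
have contract w k1' k2' : w \in O -> low w -> agree_outside O k1' k2' ->
    within_degree k1' O O -> within_degree k2' O O ->
    admissible k1' O -> admissible k2' O ->
    1 <= saw_sum #|O| O w \/ osc_le k1' k2' O (O :\ w) (saw_sum #|O| O w).
  move=> wO _ ag' d1' d2' a1' a2'; rewrite (saw_sum_card _ _ wO).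
  have [wT|wT] := boolP (w \in T).
    by left; rewrite lerDl exit_sum_ge0.
  have sub : O :\ w \subset O by apply: subD1set.
  rewrite add0r; apply: IH => //; first exact: cardD.
  - by move=> v; rewrite !inE; case: eqP => [-> //|_] /=; case: (v \in O).
  - by move=> v /(subsetP sub); apply: d1'.
  - by move=> v /(subsetP sub); apply: d2'.
have ao1 := admissible_sub beta0 beta1 OS a1.
have ao2 := admissible_sub beta0 beta1 OS a2.
have ag' : agree_outside S k2 k1 by move=> u uS uT y; rewrite ag.
move=> xi zeta.
(* The pinnings by [xi] and by [zeta] are compared separately, the second with the fields exchanged.
   Each costs [E], and the two halves of [dl] add up to [exit_sum]. *)
have [_ _ h1] := telescope OS contract xi (bedges_uniq O S) (fun _ => id) ls ag
  d1 d2 ao1 ao2.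
have [_ _ h2] := telescope OS contract zeta (bedges_uniq O S) (fun _ => id) ls ag'
  d2 d1 ao2 ao1.
set E := \sum_(e <- _) _ in h1 h2.
have QE : exit_sum O S = E + E.
  rewrite /E (sum_bedges O S (fun u w => dl w / 2 * saw_sum #|O| O w)) -big_split /=.
  apply: eq_bigr => u _; rewrite -big_split /=; apply: eq_bigr => w _.
  by rewrite -mulrDl -splitr.
(* The block avoids [T], so its internal weight is the same under both fields. *)
have Wk xi' : wt beta k1 (S :\: O) xi' = wt beta k2 (S :\: O) xi'.
  rewrite /wt (@cost_congr_field _ _ k1 k2) // => u uS; apply: ag (ST _ uS).
  by move: uS; rewrite inE => /andP[].
rewrite !(fun k xi' => Z_split beta k (subxx O) OS (fun u _ => erefl (xi' u))).
rewrite !Wk QE expRD.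
have ZO k : Zf k O O zeta = Zf k O O xi.
  by apply: Z_congr => u; rewrite inE; case: (u \in O).
rewrite !ZO in h2 *.
have pp : 0 < Zf k1 O O xi * Zf k2 O O xi by rewrite mulr_gt0 ?Z_gt0.
have h := ler_pM _ _ h1 h2.
rewrite -(ler_pM2r pp).
have w0 : 0 <= wt beta k2 (S :\: O) xi * wt beta k2 (S :\: O) zeta.
  by rewrite mulr_ge0 ?W_ge0.
have := ler_wpM2l w0 (h _ _).
rewrite !mulr_ge0 ?Z_ge0 // => /(_ isT isT) {}h.
apply: le_trans (le_trans h _).
- by rewrite le_eqVlt; apply/orP; left; apply/eqP; ring.
- by rewrite le_eqVlt; apply/orP; left; apply/eqP; ring.
Qed.

End Oscillation.

(** * Splitting the walk sum by length *)

Section SawLayers.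
Import Order.TTheory GRing.Theory Num.Theory.
Local Open Scope ring_scope.

Variables (G : graph) (R : realType).
Local Notation V := (gV G).
Local Notation adj := (@gadj G).
Variables (dl : V -> R) (T : {set V}).
Hypothesis dl_ge0 : forall v, 0 <= dl v.
Implicit Types (S O : {set V}).

Fixpoint saw_hit l O w : R :=
  if l is m.+1 then
    \sum_(u in O :\ w | adj w u) dl u * saw_hit m (O :\ w) u
  else (w \in T)%:R.

Lemma saw_sum_layers n O w : saw_sum dl T n O w = \sum_(l < n) saw_hit l O w.
Proof.
elim: n O w => [|n IH] O w /=; first by rewrite big_ord0.
rewrite big_ord_recl /=; congr (_ + _); rewrite exchange_big /=.
by apply: eq_bigr => u _; rewrite IH mulr_sumr.
Qed.

Lemma walk_toS v w (D : {set V}) l :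
  adj v w -> walk_to w D l -> walk_to v D l.+1.
Proof.
move=> vw /existsP[t /andP[p la]]; apply/existsP; exists (cons_tuple w t).
by rewrite /= vw p.
Qed.

Lemma saw_hit_eq0 l O w : ~~ walk_to w T l -> saw_hit l O w = 0.
Proof.
elim: l O w => [|l IH] O w nw /=.
  case: (boolP (w \in T)) => // wT; case/negP: nw.
  by apply/existsP; exists [tuple].
rewrite big1 // => u /andP[_ wu]; rewrite IH ?mulr0 //.
by apply: contra nw; apply: walk_toS.
Qed.

(** Peel off the first step, and at the end bound membership in [T] by 1. The condition
    [all (mem O)] is what the induction carries: with [w] deleted from [O], the rest of the walk
    cannot return to [w]. *)
Lemma saw_hit_le l O w :
  saw_hit l O w <= \sum_(t : l.-tuple V | is_saw w t && all (mem O) t)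
                      \prod_(u <- t) dl u.
Proof.
have prod_ge0 m (t : m.-tuple V) : 0 <= \prod_(u <- t) dl u.
  by apply: prodr_ge0.
elim: l O w => [|l IH] O w /=.
  rewrite (bigD1 [tuple]) //= big_nil.
  rewrite -[leLHS]addr0 lerD ?sumr_ge0 //; by case: (w \in T); rewrite ?ler01.
pose P u (t : l.-tuple V) := [&& u \in O :\ w, adj w u, is_saw u t & all (mem (O :\ w)) t].
apply: (@le_trans _ _ (\sum_u \sum_(t | P u t) dl u * \prod_(x <- t) dl x)).
  rewrite big_mkcond /=; apply: ler_sum => u _; case: ifP => [/andP[uO wu]|_]; last first.
    by apply: sumr_ge0 => t _; rewrite mulr_ge0.
  rewrite -mulr_sumr ler_wpM2l // (le_trans (IH _ _)) //.
  by rewrite le_eqVlt; apply/orP; left; apply/eqP; apply: eq_bigl => t; rewrite /P uO wu.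
rewrite pair_big_dep /=.
rewrite [leRHS](reindex (fun p : V * l.-tuple V => cons_tuple p.1 p.2)) /=; last first.
  exists (fun t : l.+1.-tuple V => (thead t, [tuple of behead t])) => [[u t] _|t _] /=.
    by congr (_, _); apply: val_inj.
  by rewrite [RHS]tuple_eta; apply: val_inj.
rewrite [leRHS](bigID (fun p => P p.1 p.2)) /=.
rewrite -[leLHS]addr0; apply: lerD; last first.
  by apply: sumr_ge0 => p _; apply: (prod_ge0 _ (cons_tuple p.1 p.2)).
rewrite [leRHS](eq_bigl (fun p => P p.1 p.2)).
  by apply: ler_sum => p _; rewrite big_cons.
move=> [u t] /=; case: (boolP (P u t)); rewrite ?andbF // andbT.
case/and4P=> uO wu /andP[pt ut] /allP aO; rewrite /is_saw /= wu pt /=.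
move: uO; rewrite !inE => /andP[uw ->]; rewrite negb_or eq_sym uw /=.
have -> : w \notin t by apply/negP => /aO; rewrite /= !inE eqxx.
move: ut => /= ->; apply/allP => x /aO; by rewrite /= !inE => /andP[].
Qed.

End SawLayers.

(** * Potts instances as fields on the free vertices *)

Section Marginals.
Import Order.TTheory GRing.Theory Num.Theory.
Local Open Scope ring_scope.

Variables (G : graph) (q : nat).
Local Notation V := (gV G).
Local Notation adj := (@gadj G).
Local Notation config := (config G q).
Implicit Types (pi xi : config).

Definition no_field : V -> 'I_q -> nat := fun _ _ => 0%N.

(** [dedge] selects one ordered pair per edge, so sending a pair to its two-element set is a
    bijection onto the monochromatic edges. *)
Lemma nmono_cost pi : nmono pi = cost no_field setT pi.
Proof.
rewrite /cost big1 // add0n pair_big_dep /=.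
pose A := [set p : V * V | dedge p.1 p.2 && (pi p.1 == pi p.2)].
have -> : (\sum_(p : V * V | (p.1 \in setT) && ((p.2 \in setT) && dedge p.1 p.2))
   (pi p.1 == pi p.2) = #|A|)%N.
  rewrite -sum1_card big_mkcond [RHS]big_mkcond; apply: eq_bigr => p _.
  by rewrite !inE; case: dedge; case: eqP.
pose f (p : V * V) := [set p.1; p.2].
have fi : {in A &, injective f}.
  move=> [u w] [u' w']; rewrite !inE /dedge /= => /andP[/andP[_ uw] _] /andP[/andP[_ uw'] _].
  rewrite /f /= => e.
  have /set2P[] : u \in [set u'; w'] by rewrite -e set21.
    move=> e1; have /set2P[] : w \in [set u'; w'] by rewrite -e set22.
      by move=> e2; rewrite e1 e2 ltnn in uw.
    by move=> ->; rewrite e1.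
  move=> e1; have /set2P[] : w \in [set u'; w'] by rewrite -e set22.
    by move=> e2; rewrite e1 e2 in uw; have := ltn_trans uw uw'; rewrite ltnn.
  by move=> e2; rewrite e1 e2 ltnn in uw.
rewrite -(card_in_imset fi); apply: eq_card => e; rewrite inE.
apply/andP/imsetP => [[]|[[u w]]].
  rewrite inE => /existsP[u /existsP[w /andP[uw /eqP ->]]] /forall_inP m.
  have muw : pi u == pi w.
    by have /forall_inP := m u (set21 _ _); apply; apply: set22.
  case: (boolP (dedge u w)) => [d|]; first by exists (u, w); rewrite // inE d.
  rewrite (dedgeC uw) negbK => d; exists (w, u); last by rewrite /f setUC.
  by rewrite inE d eq_sym.
rewrite inE /= => /andP[/andP[uw _] m] ->; split.
  by rewrite inE; apply/existsP; exists u; apply/existsP; exists w; rewrite uw eqxx.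
apply/forall_inP => x /set2P xx; apply/forall_inP => y /set2P yy.
by case: xx yy => -> [] ->; rewrite // eq_sym.
Qed.

Definition free_pins (Lam : {set V}) xi := pin (bedges (~: Lam) setT) xi no_field.

Lemma load_free_pins (Lam : {set V}) xi w :
  w \notin Lam -> (load (free_pins Lam xi) (~: Lam) w <= deg w)%N.
Proof.
move=> wL; rewrite load_pin.
have -> : deg w = load no_field setT w.
  by rewrite /load big1 //; apply: eq_card => u; rewrite !inE.
rewrite (load_split _ _ (subsetT (~: Lam))) leq_add2l.
by rewrite count_bedges_le ?bedges_uniq.
Qed.

Lemma agreesP (Lam : {set V}) (sigma : boundary q Lam) xi pi :
  agrees sigma xi -> agrees sigma pi = agree_off (~: Lam) xi pi.
Proof.
move=> /forallP ax; apply/forallP/agree_offP => h x.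
  by rewrite inE negbK => xL; rewrite (eqP (h (exist _ x xL))) -(eqP (ax (exist _ x xL))).
by rewrite h ?inE ?negbK ?(valP x).
Qed.

End Marginals.

(** * From oscillation to the difference of two marginals *)

Section MarginalDifference.
Import Order.TTheory GRing.Theory Num.Theory.
Local Open Scope ring_scope.
Local Notation R := Rdefinitions.R.

Variables (G : graph) (q : nat) (beta : R).
Local Notation V := (gV G).
Local Notation adj := (@gadj G).
Hypotheses (beta0 : 0 <= beta) (beta1 : beta < 1).

Lemma feasible_agrees (Lam : {set V}) (sigma : boundary q Lam) :
  feasible beta sigma ->
  exists2 xi : config G q, agrees sigma xi & 0 < wt beta (@no_field G q) setT xi.
Proof.
case=> xi /RltP; rewrite /weight; case: (boolP (agrees sigma xi)); last by rewrite ltxx.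
by move=> a; rewrite RpowE nmono_cost; exists xi.
Qed.

Lemma Rsum_weight (Lam : {set V}) (sigma : boundary q Lam) xi (P : pred (config G q)) :
  agrees sigma xi ->
  Rsum P (weight beta sigma)
  = \sum_(pi | agree_off (~: Lam) xi pi && P pi) wt beta (@no_field G q) setT pi.
Proof.
move=> a; rewrite /Rsum.
transitivity (\sum_(pi | P pi) weight beta sigma pi) => //.
rewrite big_mkcondl /=; apply: eq_bigr => pi _.
by rewrite /weight (agreesP _ a) RpowE nmono_cost.
Qed.

(** By [Z_split], numerator and denominator share the weight of the pinned part, which is positive
    because [xi] has positive weight, and cancels. *)
Lemma marginalE (Lam : {set V}) (sigma : boundary q Lam) xi v x :
  agrees sigma xi -> 0 < wt beta (@no_field G q) setT xi -> v \notin Lam ->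
  marginal beta sigma v x
  = Zf beta (free_pins Lam xi) (~: Lam) (~: Lam :\ v) (upd xi v x)
    / Zf beta (free_pins Lam xi) (~: Lam) (~: Lam) xi.
Proof.
move=> a p vL; have vS : v \in ~: Lam by rewrite inE.
rewrite /marginal /Zpart !(Rsum_weight _ a) RdivE.
rewrite (eq_bigl _ _ (fun pi => esym (agree_off_upd _ _ pi vS))).
rewrite [X in _ / X](eq_bigl (agree_off (~: Lam) xi)); last by move=> pi; rewrite andbT.
have sv : ~: Lam :\ v \subset ~: Lam by apply: subD1set.
rewrite -/(Zf _ _ _ _ _) -/(Zf _ _ _ _ _).
rewrite (Z_split beta _ sv (subsetT _) (eta := xi)); last first.
  by move=> u; rewrite !inE ffunE andbT negbK; case: eqP => // ->; rewrite (negbTE vL).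
rewrite (Z_split beta _ (subxx (~: Lam)) (subsetT _) (eta := xi)) //.
rewrite -mulf_div divff ?mul1r // gt_eqF //.
apply: lt_le_trans p _; apply: ler_wiXn2l; rewrite ?cost_le ?subsetT // ltW //.
Qed.

(** From [a <= expR M * b] and [1 - M <= expR (- M)] follows [a - b <= M * a <= M]. *)
Lemma diff_le_of_ratio (M p1 p2 : R) : 0 <= M -> 0 <= p1 <= 1 -> 0 <= p2 <= 1 ->
  1 <= M \/ (p1 <= expR M * p2 /\ p2 <= expR M * p1) -> `|p1 - p2| <= M.
Proof.
move=> M0 /andP[p10 p11] /andP[p20 p21] [M1|[h1 h2]].
  by rewrite ler_norml; lra.
have key a b : 0 <= a <= 1 -> a <= expR M * b -> a - b <= M.
  move=> /andP[a0 a1] h; have := ler_wpM2l (expR_ge0 (- M)) h.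
  rewrite mulrA -expRD addNr expR0 mul1r => h'.
  have := ler_wpM2r a0 (expR_ge1Dx (- M)); rewrite mulrDl mul1r mulNr.
  have : M * a <= M by rewrite ler_piMr.
  lra.
have := key _ _ (introT andP (conj p10 p11)) h1.
have := key _ _ (introT andP (conj p20 p21)) h2.
by rewrite ler_norml; lra.
Qed.

Variables (dl : V -> R) (low : pred V).
Hypothesis dl_ge0 : forall v, 0 <= dl v.
Hypothesis dl_high : forall v, ~~ low v -> dl v = 1.
Hypothesis low_gt0 :
  forall v, low v -> 0 < q%:R - (1 - beta) * (deg v)%:R.
Hypothesis dl_low : forall v, low v ->
  (1 - beta) / (q%:R - (1 - beta) * (deg v)%:R) <= dl v / 2.

(** The fields induced by [sigma] and [tau] can differ only at free neighbours of a disagreement,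
    whence [T]; [oscillation_bound] is applied to the block consisting of [v]. *)
Lemma marginal_diff_le (Lam : {set V}) (sigma tau : boundary q Lam) v x :
  let T := [set u in ~: Lam | [exists d in disagree sigma tau, adj u d]] in
  feasible beta sigma -> feasible beta tau -> v \notin Lam -> v \notin T ->
  `|marginal beta sigma v x - marginal beta tau v x|
  <= saw_sum dl T #|~: Lam| (~: Lam) v.
Proof.
move=> T /feasible_agrees[xi ax px] /feasible_agrees[zeta az pz] vL vT.
rewrite !(marginalE _ ax, marginalE _ az) //.
have vS : v \in ~: Lam by rewrite inE.
set S := ~: Lam in vS *; set O := S :\ v.
have OS : O \subset S by apply: subD1set.
set k1 := free_pins Lam xi; set k2 := free_pins Lam zeta.
have ag : agree_outside T S k1 k2.
  move=> u uS uT y; congr (_ + _)%N; apply: eq_in_count => e.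
  rewrite mem_bedges => /and3P[]; rewrite !inE andbT negbK => eL _ ea.
  case: eqP => //= eu; congr (_ == _).
  have /forallP/(_ (exist _ e.1 eL)) /eqP /= -> := ax.
  have /forallP/(_ (exist _ e.1 eL)) /eqP /= -> := az.
  apply/eqP; apply: contraNT uT => ne; rewrite inE uS /=; apply/exists_inP.
  exists e.1; last by rewrite gadj_sym -eu.
  by apply/imsetP; exists (exist _ e.1 eL).
have wd (xi' : config G q) : within_degree (free_pins Lam xi') S O.
  by move=> w /(subsetP OS); rewrite inE; apply: load_free_pins.
have adm xi' : 0 < wt beta (@no_field G q) setT xi' ->
    admissible beta (free_pins Lam xi') S.
  move=> p; exists xi'; apply: lt_le_trans p _.
  rewrite /wt (@cost_split_pin _ _ _ S setT xi' xi') ?subsetT //.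
  by apply: ler_wiXn2l; rewrite ?leq_addl // ltW.
have OT u : u \in S :\: O -> u \notin T.
  by rewrite in_setD in_setD1; case: eqP => [-> _ //|_] /=; case: (u \in S).
have := oscillation_bound beta0 beta1 dl_ge0 dl_high low_gt0 dl_low OS ag OT
  (wd xi) (wd zeta) (adm _ px) (adm _ pz).
rewrite saw_sum_card // (negbTE vT) add0r -/O => osc.
have M0 := exit_sum_ge0 T dl_ge0 O S.
have Zp xi' : 0 < wt beta (@no_field G q) setT xi' -> 0 < Zf beta (free_pins Lam xi') S S xi'.
  by move=> p; apply: Z_gt0 => //; apply: adm.
have p01 xi' : 0 < wt beta (@no_field G q) setT xi' ->
   0 <= Zf beta (free_pins Lam xi') S O (upd xi' v x)
        / Zf beta (free_pins Lam xi') S S xi' <= 1.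
  move=> p; rewrite divr_ge0 ?Z_ge0 //= ler_pdivrMr ?Zp // mul1r.
  exact: Z_le_partition.
apply: diff_le_of_ratio => //; [exact: p01|exact: p01|].
case: osc => [|osc]; [by left|right].
have e2 : Zf beta k2 S S xi = Zf beta k2 S S zeta.
  by apply: Z_congr => u; rewrite setDv inE.
have e3 : Zf beta k2 S O (upd xi v x) = Zf beta k2 S O (upd zeta v x).
  apply: Z_congr => u; rewrite /O !ffunE !inE; case: eqP => //= _.
  by case: (u \in Lam).
(* Exchanging the two colourings exchanges the fields, so one bound yields both ratios. *)
have osc' : osc_le beta k2 k1 S O (exit_sum dl T O S).
  by move=> a b; have := osc b a; rewrite ![Zf beta k1 _ _ _ * _]mulrC.
split; rewrite mulrA ler_pdivrMr ?Zp // mulrAC ler_pdivlMr ?Zp //.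
- have := osc_le_point xi x vS osc'; rewrite e2 e3.
  by rewrite [leLHS]mulrC => /le_trans; apply; rewrite -mulrA.
- have := osc_le_point xi x vS osc; rewrite e2 e3.
  by rewrite [leLHS]mulrC => /le_trans; apply; rewrite -mulrA.
Qed.

End MarginalDifference.

Local Open Scope R_scope.

(** * Geometric tails and the final constants *)

Section Assembly.
Import Order.TTheory GRing.Theory Num.Theory.
Local Open Scope ring_scope.
Local Notation R := Rdefinitions.R.

Lemma sum_geometric_tail (g : R) N L : g < 1 -> 0 <= g ->
  \sum_(l < N | (L <= l)%N) g ^+ l <= g ^+ L / (1 - g).
Proof.
move=> g1 g0; rewrite ler_pdivlMr ?subr_gt0 //.
suff -> : (\sum_(l < N | (L <= l)%N) g ^+ l) * (1 - g) = g ^+ L - g ^+ maxn N L.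
  by rewrite gerBl exprn_ge0.
elim: N => [|N IH]; first by rewrite big_ord0 mul0r max0n subrr.
rewrite big_mkcond big_ord_recr -big_mkcond /= mulrDl IH.
case: leqP => LN.
  have -> : maxn N.+1 L = N.+1 by lia.
  by rewrite exprS; ring.
have -> : maxn N.+1 L = L by lia.
ring.
Qed.

Lemma ln_ge_half n : (2 <= n)%N -> 1 / 2 <= Rpower.ln n%:R :> R.
Proof.
move=> n2; apply: (@le_trans _ _ (Rpower.ln 2%:R)).
  have e : IZR 2 = 2%:R :> R by rewrite -INRE.
  by move: ln_lt_2; rewrite e => /RltP/ltW; rewrite RinvE div1r.
apply/RleP; case: (ltngtP 2 n) n2 => // [n2|<-] _; last exact: Rle_refl.
apply/Rlt_le/ln_increasing; apply/RltP; first by rewrite ltr0n.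
by rewrite ltr_nat.
Qed.

Lemma Rpower_ge1 n C : (0 < n)%N -> 0 <= C -> 1 <= Rpower n%:R C.
Proof.
move=> n0 C0; apply: (@le_trans _ _ (1 + C * Rpower.ln n%:R)); last first.
  by apply/RleP; apply: exp_ineq1_le.
rewrite lerDl mulr_ge0 //; case: n n0 => [//|[_|n _]]; first by rewrite ln_1.
by have := @ln_ge_half n.+2 isT; lra.
Qed.

Lemma Rpower_ge_half n K : (2 <= n)%N -> 0 <= K -> K / 2 <= Rpower n%:R K.
Proof.
move=> n2 K0; apply: (@le_trans _ _ (1 + K * Rpower.ln n%:R)).
  have := ler_wpM2l K0 (ln_ge_half n2); lra.
by apply/RleP; apply: exp_ineq1_le.
Qed.

(** Being low means [q - 1 - (1 - beta) d >= 2 (1 - beta)], so the denominators are positive; that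
    of [delta_potts] is smaller by 1, which gives the last inequality. *)
Lemma delta_pottsP q (beta : R) d : 0 <= beta -> beta < 1 ->
  let low := d%:R <= (q%:R - 1) / (1 - beta) - 2 :> R in
  [/\ ~~ low -> delta_potts q beta d = 1,
      low -> 0 < q%:R - (1 - beta) * d%:R &
      low -> (1 - beta) / (q%:R - (1 - beta) * d%:R) <= delta_potts q beta d / 2].
Proof.
move=> b0 b1 low.
have dec : delta_potts q beta d =
    if low then 2 * (1 - beta) / (q%:R - 1 - (1 - beta) * d%:R) else 1.
  have e2 : IZR 2 = 2%:R :> R by rewrite -INRE.
  rewrite /delta_potts !INRE !RdivE e2; case: Rle_dec => /= [/RleP h|nh].
    by have -> : low by exact: h.
  by case: ifP => // h; case: nh; apply/RleP; exact: h.
have a0 : 0 < 1 - beta by lra.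
have lowE : low -> 2 * (1 - beta) <= q%:R - 1 - (1 - beta) * d%:R.
  rewrite /low lerBrDr ler_pdivlMr //; lra.
split=> [/negbTE e|/lowE|l].
- by rewrite dec e.
- lra.
have := lowE l; rewrite dec l => h.
have p1 : 0 < q%:R - 1 - (1 - beta) * d%:R by lra.
have p2 : 0 < q%:R - (1 - beta) * d%:R by lra.
have -> : 2 * (1 - beta) / (q%:R - 1 - (1 - beta) * d%:R) / 2
  = (1 - beta) / (q%:R - 1 - (1 - beta) * d%:R) by field; rewrite gt_eqF.
by rewrite ler_pM2l // lef_pV2 ?posrE //; lra.
Qed.

Section Graph.
Variable G : graph.
Local Notation V := (gV G).
Local Notation adj := (@gadj G).

(** Layers shorter than [L] miss [T] and vanish; the others are at most [Edelta]. [0 < L] keeps to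
    positive lengths, the ones that the contraction bound covers. *)
Lemma saw_sum_le_tail (delta : nat -> R) (T O : {set V}) n v (A g : R) L :
  (forall d, 0 <= delta d) -> 0 <= A -> 0 <= g -> g < 1 -> (0 < L)%N ->
  (forall l, (0 < l)%N -> Edelta delta v l <= A * g ^+ l) ->
  (forall l, (l < L)%N -> ~~ walk_to v T l) ->
  saw_sum (fun u => delta (deg u)) T n O v <= A * (g ^+ L / (1 - g)).
Proof.
move=> d0 A0 g0 g1 L0 hE hW; rewrite saw_sum_layers.
rewrite (bigID (fun l : 'I_n => (L <= l)%N)) /= [X in _ + X]big1 ?addr0; last first.
  by move=> l; rewrite -ltnNge => /hW h; apply: saw_hit_eq0.
apply: (@le_trans _ _ (\sum_(l < n | (L <= l)%N) A * g ^+ l)).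
  apply: ler_sum => l Ll; apply: le_trans (hE l (leq_trans L0 Ll)).
  apply: le_trans (saw_hit_le _ _ _ _ _) _ => //.
  rewrite /Edelta /Rsum -[leRHS]/(\sum_(t | is_saw v t) \prod_(u <- tval t) delta (deg u)).
  rewrite [leRHS](bigID (fun t : l.-tuple V => all (mem O) t)) /= lerDl.
  by apply: sumr_ge0 => t _; apply: prodr_ge0.
by rewrite -mulr_sumr ler_wpM2l ?sum_geometric_tail.
Qed.

Lemma walk_to_rcons v (T D : {set V}) l :
  (forall u, u \in T -> exists2 d, d \in D & adj u d) ->
  walk_to v T l -> walk_to v D l.+1.
Proof.
move=> TD /existsP[t /andP[p /TD[d dD a]]]; apply/existsP.
by exists (rcons_tuple t d); rewrite /= rcons_path p a last_rcons.
Qed.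

Variables (q : nat) (beta : R).
Hypotheses (beta0 : 0 <= beta) (beta1 : beta < 1).

Lemma weight_ge0 (Lam : {set V}) (sigma : boundary q Lam) pi :
  0 <= weight beta sigma pi.
Proof. by rewrite /weight; case: ifP => // _; rewrite RpowE exprn_ge0. Qed.

Lemma Zpart_gt0 (Lam : {set V}) (sigma : boundary q Lam) :
  feasible beta sigma -> 0 < Zpart beta sigma.
Proof.
move=> [pi /RltP p].
rewrite -[ltRHS]/(\sum_pi weight beta sigma pi) (bigD1 pi) //=.
by apply: ltr_pwDl => //; apply: sumr_ge0 => *; apply: weight_ge0.
Qed.

Lemma marginal_01 (Lam : {set V}) (sigma : boundary q Lam) v x :
  feasible beta sigma -> 0 <= marginal beta sigma v x <= 1.
Proof.
move=> /Zpart_gt0 p; rewrite /marginal RdivE.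
rewrite -[Rsum _ _]/(\sum_(pi : config G q | pi v == x) weight beta sigma pi).
rewrite divr_ge0 ?ler_pdivrMr ?(ltW p) //=; last first.
  by apply: sumr_ge0 => *; apply: weight_ge0.
rewrite mul1r -[leRHS]/(\sum_pi weight beta sigma pi).
rewrite [leRHS](bigID (fun pi : config G q => pi v == x)) /= lerDl.
by apply: sumr_ge0 => *; apply: weight_ge0.
Qed.

Lemma marginal_pinned (Lam : {set V}) (sigma : boundary q Lam) v (vL : v \in Lam) x :
  feasible beta sigma ->
  marginal beta sigma v x = (sigma (exist _ v vL) == x)%:R.
Proof.
move=> /Zpart_gt0 p; rewrite /marginal RdivE.
rewrite -[Rsum _ _]/(\sum_(pi : config G q | pi v == x) weight beta sigma pi).
have w0 (pi : config G q) : pi v != sigma (exist _ v vL) -> weight beta sigma pi = 0.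
  rewrite /weight; case: ifP => // /forallP/(_ (exist _ v vL)) /eqP /= ->.
  by rewrite eqxx.
case: eqP => [e|/eqP ne]; last first.
  rewrite big1 ?mul0r // => pi /eqP e; apply: w0; by rewrite e eq_sym.
suff <- : Zpart beta sigma = \sum_(pi : config G q | pi v == x) weight beta sigma pi.
  by rewrite divff ?gt_eqF.
rewrite -[LHS]/(\sum_pi weight beta sigma pi).
rewrite (bigID (fun pi : config G q => pi v == x)) /= [X in _ + X]big1 ?addr0 //.
by move=> pi ne; apply: w0; rewrite e.
Qed.

(* A positive finite distance forces at least two vertices, so the factor [n^K]
   absorbs the constant [1 / (g * (1 - g))] of the geometric tail. *)
Lemma marginal_diff_le_pow_dist (C g : R) (v : V) (Lam : {set V}) (x : 'I_q)
    (sigma tau : boundary q Lam) (K := 2 / (g * (1 - g))) :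
  (forall d, 0 <= delta_potts q beta d) -> 0 <= C -> 0 < g -> g < 1 ->
  (forall l, (0 < l)%N ->
    Edelta (delta_potts q beta) v l <= Rpower (nverts G)%:R C * g ^+ l) ->
  feasible beta sigma -> feasible beta tau ->
  `|marginal beta sigma v x - marginal beta tau v x|
  <= Rpower (nverts G)%:R (C + K)
     * pow_dist g v (disagree sigma tau).
Proof.
move=> d0 C0 g0 g1 hE fs ft; set D := disagree _ _.
set n := nverts G; have n0 : (0 < n)%N by apply/card_gt0P; exists v.
have gg : 0 < g * (1 - g) by rewrite mulr_gt0 // subr_gt0.
have K0 : 0 <= K by rewrite divr_ge0 // ltW.
have CK1 : 1 <= Rpower n%:R (C + K) by rewrite Rpower_ge1 // addr_ge0.
have le1 : `|marginal beta sigma v x - marginal beta tau v x| <= 1.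
  have /andP[? ?] := marginal_01 v x fs; have /andP[? ?] := marginal_01 v x ft.
  by rewrite ler_norml; lra.
have eqL : v \in Lam -> v \notin D ->
    marginal beta sigma v x - marginal beta tau v x = 0.
  move=> vL vD; rewrite !(marginal_pinned vL) //.
  case: (eqVneq (sigma (exist _ v vL)) (tau (exist _ v vL))) => [->|ne].
    by rewrite subrr.
  by case/imsetP: vD; exists (exist _ v vL).
pose T := [set u in ~: Lam | [exists d in D, adj u d]].
have TD u : u \in T -> exists2 d, d \in D & adj u d.
  by rewrite inE => /andP[_ /exists_inP].
have main : v \notin Lam -> v \notin T ->
    `|marginal beta sigma v x - marginal beta tau v x|
    <= saw_sum (fun u => delta_potts q beta (deg u)) T #|~: Lam| (~: Lam) v.
  have P (u : V) := delta_pottsP q (deg u) beta0 beta1.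
  by apply: (marginal_diff_le beta0 beta1 (low := fun u : V =>
    (deg u)%:R <= (q%:R - 1) / (1 - beta) - 2)) => // u; case: (P u).
have walk0 (A : {set V}) : v \in A -> walk_to v A 0.
  by move=> vA; apply/existsP; exists [tuple].
rewrite /pow_dist; case: excluded_middle_informative => [h|nw]; last first.
  have nwD l : ~~ walk_to v D l by apply/negP => ?; apply: nw; exists l.
  have nwT l : ~~ walk_to v T l.
    by apply: contra (nwD l.+1); apply: walk_to_rcons.
  rewrite [_ * _]mulr0; case: (boolP (v \in Lam)) => vL.
    by rewrite eqL ?normr0 //; apply: contra (nwD 0%N); apply: walk0.
  apply: le_trans (main vL _) _; first by apply: contra (nwT 0%N); apply: walk0.
  by rewrite saw_sum_layers big1 // => l _; apply: saw_hit_eq0.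
case: ex_minnP => d wd mind; rewrite RpowE.
have [->|dpos] := posnP d; first by rewrite expr0 mulr1; apply: le_trans CK1.
have vD : v \notin D by apply/negP => /walk0/mind; rewrite leqNgt dpos.
case: (boolP (v \in Lam)) => vL.
  by rewrite eqL // normr0 mulr_ge0 ?exprn_ge0 ?(ltW g0) //; apply: le_trans CK1.
have n2 : (2 <= n)%N.
  have /existsP[t /andP[_ tD]] := wd.
  have /card_gt1P : exists a b, [/\ a \in V, b \in V & a != b].
    by exists v, (last v t); split=> //; apply: contraNneq vD => ->.
  by [].
(* The 2 in [K] makes up for the factor [1 / 2] in [Rpower_ge_half]. *)
have K1 : 1 / (g * (1 - g)) <= Rpower n%:R K.
  by apply: le_trans (Rpower_ge_half n2 K0); rewrite /K mulrAC divff ?pnatr_eq0.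
have CKE : Rpower n%:R (C + K) = Rpower n%:R C * Rpower n%:R K by apply: Rpower_plus.
have C1 : 1 <= Rpower n%:R C by apply: Rpower_ge1.
have K1' : 1 <= Rpower n%:R K * (g * (1 - g)) by move: K1; rewrite ler_pdivrMr.
(* At distance 1 the free vertex [v] lies in [T], where [main] does not apply; the trivial bound 1
   suffices, as [Rpower n%:R K * g] is at least 1. *)
have [d1|d2] := leqP d 1.
  have -> : d = 1%N by apply/eqP; rewrite eqn_leq d1.
  apply: le_trans le1 _; rewrite expr1 CKE -mulrA.
  have : Rpower n%:R K * (g * (1 - g)) <= Rpower n%:R K * g.
    rewrite mulrA ler_piMr ?mulr_ge0 ?(ltW g0) //; last lra.
    by apply: le_trans (Rpower_ge1 n0 K0).
  move=> /(le_trans K1') Kg; rewrite -[leLHS]mulr1; exact: ler_pM.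
(* Each vertex of [T] is one step from [D], so walks to [T] may be one edge shorter than [d]; the
   lost power of [g] is the [1 / g] in [K]. *)
have nwT l : (l < d.-1)%N -> ~~ walk_to v T l.
  by move=> ld; apply/negP => /(walk_to_rcons TD)/mind; rewrite leqNgt -ltn_predRL ld.
have d1p : (0 < d.-1)%N by rewrite ltn_predRL.
have vT : v \notin T by apply/negP => /walk0; apply/negP/nwT.
apply: (le_trans (main vL vT)).
have Cp : 0 <= Rpower n%:R C by apply: le_trans C1.
apply: le_trans (saw_sum_le_tail _ _ d0 Cp (ltW g0) g1 d1p hE nwT) _.
rewrite CKE -mulrA; apply: ler_wpM2l => //.
rewrite ler_pdivrMr ?subr_gt0 // -[in leRHS](prednK dpos) exprS.
have -> : Rpower n%:R K * (g * g ^+ d.-1) * (1 - g)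
  = Rpower n%:R K * (g * (1 - g)) * g ^+ d.-1 by ring.
by rewrite ler_peMl // exprn_ge0 // ltW.
Qed.

End Graph.
End Assembly.

Theorem mainTheorem2 (q : nat) (beta : R) (fam : graph -> Prop) :
  (3 <= q)%N -> (0 <= beta < 1) ->
  contraction fam (delta_potts q beta) ->
  (beta = 0 -> forall G : graph, fam G -> q_colorable G q) ->
  exists (C gamma : R), (0 < C) /\ (0 < gamma < 1) /\
    forall G : graph, fam G ->
    forall (v : gV G) (Lam : {set gV G}) (x : 'I_q)
           (sigma tau : boundary q Lam),
      feasible beta sigma -> feasible beta tau ->
      (Rabs (marginal beta sigma v x - marginal beta tau v x)
        <= Rpower (INR (nverts G)) C * pow_dist gamma v (disagree sigma tau)).
Proof.
move=> _ [/RleP b0 /RltP b1] [d0 [C [g [/RltP C0 [[/RltP g0 /RltP g1] hE]]]]] _.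
(* The rate of the contraction is kept; only the power of [n] grows. *)
exists (C + 2 / (g * (1 - g))), g; split; [|split; first by split; apply/RltP].
  apply: Rplus_lt_0_compat; first exact/RltP.
  apply: Rdiv_lt_0_compat; first by Lra.lra.
  by apply: Rmult_lt_0_compat; [exact/RltP|apply: Rlt_Rminus; exact/RltP].
move=> G fG v Lam x sigma tau fs ft; apply/RleP; rewrite RabsE INRE.
apply: (marginal_diff_le_pow_dist b0 b1 x _ (Order.POrderTheory.ltW C0) g0 g1) => //.
  by move=> d; apply/Order.POrderTheory.ltW/RltP.
move=> l l0; apply/Order.POrderTheory.ltW/RltP.
by have := hE G fG v l l0; rewrite INRE RpowE.
Qed.
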